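(* In the known-positions setting, the Random Dictatorship (RD) mechanism is universally group-strategyproof.
   Context: Setting: a finite nonempty set $N$ of $n$ agents and two facilities $1,2$. Agent $i$ has a position $x_i\in[0,1]$ and an approval preference $t_i=(t_{i1},t_{i2})\in\{0,1\}^2$ ($t_{ij}=1$ iff $i$ approves facility $j$); every agent approves one of the two facilities or both. An instance is $I=(\mathbf{x},\mathbf{t})$ with $\mathbf{x}=(x_i)_{i\in N}$, $\mathbf{t}=(t_i)_{i\in N}$. If facility $j$ is located at $y\in[0,1]$ (a single facility is located), agent $i$ has utility $u_i(j,y|I)=t_{ij}(1-|x_i-y|)$; the social welfare is $W(j,y|I)=\sum_{i\in N}u_i(j,y|I)$ and $W^*(I)=\max_{(j,y)}W(j,y|I)$. The optimal facility for $I$ is a facility $j$ with $\max_y W(j,y|I)=W^*(I)$. A deterministic mechanism maps each (reported) instance to an outcome $(j,y)\in\{1,2\}\times[0,1]$. In the known-positions setting the positions are public and agents can misreport only their preferences. A deterministic mechanism is group-strategyproof if no coalition of agents can simultaneously misreport such that the utility of every agent in the coalition (computed with the true data) strictly increases. A randomized mechanism is universally group-strategyproof if it is a probability distribution over deterministic group-strategyproof mechanisms. RD mechanism: choose an agent $i$ uniformly at random. If agent $i$ approves a single facility $j$, locate $j$ at $x_i$. If agent $i$ approves both facilities, locate the optimal one (for the reported instance) at $x_i$. *)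

(* Defs.v *)
From HB Require Import structures.
From mathcomp Require Import all_boot all_order all_algebra.
From mathcomp Require Import all_classical all_reals all_analysis.

Set Implicit Arguments.
Unset Strict Implicit.
Unset Printing Implicit Defensive.

Import Order.TTheory GRing.Theory Num.Theory.
Import numFieldNormedType.Exports.

Local Open Scope classical_set_scope.
Local Open Scope ring_scope.

(* A copy of bool, which carries the discrete sigma-algebra in the library. *)
Definition facility : Type := bool.

Definition facility1 : facility := false.
Definition facility2 : facility := true.
Definition other (j : facility) : facility := ~~ j.

Definition outcome (R : realType) : Type := (facility * R)%type.

Definition valid_outcome {R : realType} (o : outcome R) : Prop :=
  0 <= o.2 <= 1.

Record instance (R : realType) (N : finType) := Instance {
  pos : N -> R;
  approves : N -> facility -> bool;
  pos_itv : forall i, 0 <= pos i <= 1;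
  approves_some : forall i, approves i facility1 || approves i facility2
}.

Section Welfare.
Variables (R : realType) (N : finType).
Implicit Types (I : instance R N) (j : facility) (y : R) (o : outcome R).

Definition utility I (i : N) o : R :=
  (approves I i o.1)%:R * (1 - `|pos I i - o.2|).

Definition welfare I o : R := \sum_(i : N) utility I i o.

(* These suprema are maxima, the welfare being continuous in the location. *)
Definition facility_welfare I j : R :=
  sup [set welfare I (j, y) | y in [set y : R | 0 <= y <= 1]].

Definition opt_welfare I : R := sup [set welfare I o | o in valid_outcome].

Definition optimal I j : bool := facility_welfare I j == opt_welfare I.

(* The optimal facility, or [tb] when both facilities are optimal. *)
Definition optimal_facility (tb : facility) I : facility :=
  if optimal I tb then tb else other tb.

End Welfare.

Record det_mechanism (R : realType) (N : finType) := DetMechanism {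
  det_outcome :> instance R N -> outcome R;
  det_outcome_valid : forall I, valid_outcome (det_outcome I)
}.

Definition rand_mechanism (R : realType) (N : finType) : Type :=
  instance R N -> probability (outcome R) R.

(* Known positions: the true instance [I] and the reported one [I'] have the
   same positions, and they differ only in the preferences of the members of
   the coalition [S]. *)
Definition misreport (R : realType) (N : finType) (S : {set N})
    (I I' : instance R N) : Prop :=
  pos I' =1 pos I /\ forall i, i \notin S -> approves I' i =1 approves I i.

Definition group_strategyproof (R : realType) (N : finType)
    (M : det_mechanism R N) : Prop :=
  ~ exists (I I' : instance R N) (S : {set N}),
      [/\ (0 < #|S|)%N, misreport S I I' &
          forall i, i \in S -> utility I i (M I) < utility I i (M I')].

(* The sample w is drawn independently of the report I; the output of the
   randomized mechanism is then that of the deterministic mechanism F w. *)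
Definition universally_group_strategyproof (R : realType) (N : finType)
    (M : rand_mechanism R N) : Prop :=
  exists (d : measure_display) (Omega : measurableType d)
         (P : probability Omega R) (F : Omega -> det_mechanism R N),
    (forall w, group_strategyproof (F w)) /\
    (forall I, measurable_fun setT (fun w => F w I) /\
       forall A, measurable A -> M I A = P ((fun w => F w I) @^-1` A)).

Section UniformLaw.
Context {d : measure_display} {T : measurableType d} {R : realType}.
Variables (N : finType) (N_gt0 : (0 < #|N|)%N).

(* The law of [f i] when i is drawn uniformly at random from N. *)
Definition uniform_law of (0 < #|N|)%N := fun (f : N -> T) (A : set T) =>
  ((\sum_(i : N) \1_A (f i)) / #|N|%:R : R)%:E.

Variable f : N -> T.
Local Notation law := (uniform_law N_gt0 f).

Let uniform_law0 : law set0 = 0%E.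
Proof.
by rewrite /uniform_law big1 ?mul0r// => i _; rewrite indic0.
Qed.

Let uniform_law_ge0 A : (0 <= law A)%E.
Proof.
by rewrite lee_fin divr_ge0// sumr_ge0// => i _; rewrite indicE.
Qed.

Let uniform_law_msum (A : set T) : law A =
  (\sum_(i : N) (#|N|%:R^-1)%:E * \d_(f i) A)%E.
Proof.
rewrite /uniform_law mulr_suml -sumEFin; apply: eq_bigr => i _.
by rewrite diracE indicE EFinM muleC.
Qed.

Let uniform_law_sigma_additive : semi_sigma_additive law.
Proof.
move=> /= F mF tF mUF; rewrite uniform_law_msum.
under eq_cvg => n.
  under eq_bigr do rewrite uniform_law_msum.
  rewrite exchange_big/=.
  over.
apply: cvg_nnesum => [i _|i _].
  by apply: nearW => n; apply: sume_ge0 => k _; rewrite mule_ge0// lee_fin.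
have r0 : 0 <= (#|N|%:R^-1 : R) by rewrite invr_ge0.
exact: (@measure_semi_sigma_additive _ _ _
  (mscale (NngNum r0) (dirac (f i))) F mF tF mUF).
Qed.

HB.instance Definition _ := isMeasure.Build _ _ _ law
  uniform_law0 uniform_law_ge0 uniform_law_sigma_additive.

Let uniform_law_setT : law setT = 1%E.
Proof.
rewrite /uniform_law; under eq_bigr do rewrite indicT.
by rewrite sumr_const divff// pnatr_eq0 -lt0n.
Qed.

HB.instance Definition _ :=
  @Measure_isProbability.Build _ _ _ law uniform_law_setT.

End UniformLaw.

Section RandomDictatorship.
Variables (R : realType) (N : finType).

(* Ties between the two facilities must be broken independently of the reported
   preferences: otherwise an agent could turn a tie into another tie that is
   resolved in its favor. The rule [tb] may depend on the dictator and on the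
   (public) positions; a fixed order on the facilities is the constant case. *)
Definition dictator_facility (tb : N -> (N -> R) -> facility) (i : N)
    (I : instance R N) : facility :=
  if approves I i facility1 && approves I i facility2
  then optimal_facility (tb i (pos I)) I
  else if approves I i facility1 then facility1 else facility2.

Definition dictator_outcome tb (i : N) (I : instance R N) : outcome R :=
  (dictator_facility tb i I, pos I i).

Definition RD (N_gt0 : (0 < #|N|)%N) tb : rand_mechanism R N :=
  fun I => uniform_law N_gt0 (fun i => dictator_outcome tb i I).

End RandomDictatorship.

(* Main.v *)
(** Fix a dictator [i]. Within a coalition that strictly gains, [i] cannot be a
    member, since its utility is already maximal; hence its report is unchanged
    and the outcome moves from [(j, x_i)] to [(k, x_i)] with [k <> j], where [i]
    approves both facilities. Everybody in the coalition then truly approves [k]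
    only, so any misreport can only raise the welfare of [j] and lower that of
    [k] at every location, which cannot make [k] the optimal facility. *)
Require Import Defs.
From HB Require Import structures.
From mathcomp Require Import all_boot all_order all_algebra.
From mathcomp Require Import all_classical all_reals all_analysis.
From mathcomp Require Import lra.

Set Implicit Arguments.
Unset Strict Implicit.
Unset Printing Implicit Defensive.

Import Order.TTheory GRing.Theory Num.Theory.

Local Open Scope classical_set_scope.
Local Open Scope ring_scope.

Section OptimalFacility.
Variables (R : realType) (N : finType).
Implicit Types (I : instance R N) (j : facility) (y : R) (o : outcome R).

Lemma proximity_ge0 I i y : 0 <= y <= 1 -> 0 <= 1 - `|pos I i - y|.
Proof.
move=> /andP[y0 y1]; have /andP[x0 x1] := pos_itv I i.
by rewrite subr_ge0 ler_norml; lra.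
Qed.

Lemma utility_le1 I i o : utility I i o <= 1.
Proof.
by rewrite /utility; case: approves; rewrite ?mul1r ?mul0r ?lerBlDr ?lerDl.
Qed.

Lemma welfare_le_card I o : welfare I o <= #|N|%:R.
Proof. by rewrite -sumr_const ler_sum// => i _; exact: utility_le1. Qed.

Lemma welfare_le_facility_welfare I j y : 0 <= y <= 1 ->
  welfare I (j, y) <= facility_welfare I j.
Proof.
move=> y01; apply: ub_le_sup; last by exists y.
by exists #|N|%:R => _ [z _ <-]; exact: welfare_le_card.
Qed.

Lemma facility_welfare_le_ub I j (c : R) :
  (forall y, 0 <= y <= 1 -> welfare I (j, y) <= c) -> facility_welfare I j <= c.
Proof.
move=> le_c; apply: ge_sup; last by move=> _ [y y01 <-]; exact: le_c.
by exists (welfare I (j, 0)), 0; rewrite //= lexx ler01.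
Qed.

Lemma facility_welfare_le_opt I j : facility_welfare I j <= opt_welfare I.
Proof.
apply: facility_welfare_le_ub => y y01; apply: ub_le_sup; last by exists (j, y).
by exists #|N|%:R => _ [z _ <-]; exact: welfare_le_card.
Qed.

(** With only two facilities, [opt_welfare] is the larger of their two suprema. *)
Lemma optimalE I j :
  optimal I j = (facility_welfare I (other j) <= facility_welfare I j).
Proof.
apply/eqP/idP => [->|le_j]; first exact: facility_welfare_le_opt.
apply/eqP; rewrite eq_le facility_welfare_le_opt /=.
apply: ge_sup.
  by exists (welfare I (j, 0)), (j, 0); rewrite // /valid_outcome/= lexx ler01.
move=> _ [[k y] y01 <-].
apply: (le_trans (welfare_le_facility_welfare _ _ y01)).
by move: le_j; rewrite /other; case: j; case: (k) => /=.
Qed.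

Lemma le_facility_welfare I I' j : pos I' =1 pos I ->
  (forall i, approves I i j -> approves I' i j) ->
  facility_welfare I j <= facility_welfare I' j.
Proof.
move=> posE app; apply: facility_welfare_le_ub => y y01.
apply: le_trans (welfare_le_facility_welfare I' j y01).
apply: ler_sum => i _; rewrite /utility posE/= ler_wpM2r ?proximity_ge0//.
by rewrite ler_nat; case: (approves I i j) (app i) => // ->.
Qed.

(** The welfare of the chosen facility cannot fall and that of the other cannot rise; as [tb] is the
    same for both instances, a tie is resolved the same way. *)
Lemma optimal_facility_stable tb I I' : pos I' =1 pos I ->
  (forall i, approves I i (optimal_facility tb I) ->
     approves I' i (optimal_facility tb I)) ->
  (forall i, approves I' i (other (optimal_facility tb I)) ->
     approves I i (other (optimal_facility tb I))) ->
  optimal_facility tb I' = optimal_facility tb I.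
Proof.
move=> posE; rewrite /optimal_facility; case: ifPn; rewrite optimalE => opt.
  move=> up down; rewrite optimalE.
  have := le_facility_welfare posE up.
  have := le_facility_welfare (fsym posE) down.
  by move=> le1 le2; rewrite (le_trans le1 (le_trans opt le2)).
(* Here [tb] lost, so the other facility is strictly better; strictness must survive, since a tie at
   [I'] would go to [tb]. *)
rewrite /other negbK => up down; rewrite optimalE ifF//; apply/negbTE.
move: opt; rewrite -!ltNge => opt.
apply: le_lt_trans (le_facility_welfare (fsym posE) down) _.
exact: lt_le_trans opt (le_facility_welfare posE up).
Qed.

End OptimalFacility.

Section Dictatorship.
Variables (R : realType) (N : finType) (tb : N -> (N -> R) -> facility).

Lemma approves_dictator_facility i (I : instance R N) :
  approves I i (dictator_facility tb i I).
Proof.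
rewrite /dictator_facility; have := approves_some I i.
case: ifP => [/andP[? ?] _|]; first by case: optimal_facility.
by case: ifP.
Qed.

Lemma dictator_outcome_valid i (I : instance R N) :
  valid_outcome (dictator_outcome tb i I).
Proof. exact: pos_itv. Qed.

Definition dictatorship i := DetMechanism (dictator_outcome_valid i).

Lemma dictatorship_gsp i : group_strategyproof (dictatorship i).
Proof.
move=> [I [I' [S [/card_gt0P[s sS] [posE appE] gain]]]].
have iNS : i \notin S.
  apply/negP => /gain; rewrite ltNge => /negP; apply.
  apply: le_trans (utility_le1 _ _ _) _.
  by rewrite /utility/= approves_dictator_facility subrr normr0 subr0 mul1r.
suff E : dictator_facility tb i I' = dictator_facility tb i I.
  by have := gain s sS; rewrite /= /dictator_outcome E posE ltxx.
(* Both outcomes lie at [pos I i], so only a change of approval from 0 to 1 gives a strict gain. *)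
have gainE a : a \in S -> ~~ approves I a (dictator_facility tb i I) /\
    approves I a (dictator_facility tb i I').
  move=> /gain; rewrite /utility/= posE.
  have := proximity_ge0 I a (pos_itv I i).
  by do 2![case: approves] => ?; rewrite ?mul1r ?mul0r ?ltxx// ltNge => /negP[].
have [//|neq] := eqVneq (dictator_facility tb i I') (dictator_facility tb i I).
have otherE : dictator_facility tb i I' = other (dictator_facility tb i I).
  by move: neq; case: dictator_facility; case: dictator_facility.
rewrite otherE in gainE.
(* As [i] is outside [S], its report and the tie-break are those of [I]; only the argument of
   [optimal_facility] changes. *)
have -> : dictator_facility tb i I' =
    if approves I i facility1 && approves I i facility2
    then optimal_facility (tb i (pos I)) I'
    else if approves I i facility1 then facility1 else facility2.
  by rewrite /dictator_facility !appE// (funext posE).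
move: gainE; rewrite /dictator_facility; case: ifP => // _ gainE.
(* Inside [S] the first condition has a false premise and the second a true conclusion; outside [S]
   approvals agree. *)
apply: optimal_facility_stable => // a;
  by case: (boolP (a \in S)) => [/gainE[/negbTE aj ak]|/appE->//];
  rewrite ?aj ?ak.
Qed.

End Dictatorship.

Theorem theorem5p2 (R : realType) (N : finType) (N_gt0 : (0 < #|N|)%N)
    (tb : N -> (N -> R) -> facility) :
  universally_group_strategyproof (RD N_gt0 tb).
Proof.
(* [i0] is the default of [nth]: samples from [#|N|] on have probability zero, yet must also yield a
   group-strategyproof mechanism. *)
have [i0 _] := card_gt0P N_gt0.
(* The sample is the rank of the dictator, since [nat], unlike [N], carries the
   discrete sigma-algebra in the library. *)
exists _, nat, (uniform_law N_gt0 (fun i : N => enum_rank i : nat)),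
  (fun w => dictatorship tb (nth i0 (enum N) w)).
split=> [w|I]; first exact: dictatorship_gsp.
split=> // A _; rewrite /RD /= /uniform_law; congr (_ / _)%:E.
by apply: eq_bigr => i _; rewrite !indicE -{1}[i](nth_enum_rank i0).
Qed.
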